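(* Let $X$ be a Hausdorff space and let $\tau^c$ be the family of all closed subsets of $X$. Then $X$ is stratifiable if and only if one can assign to each $F\in\tau^c$ a lower semi-continuous function $f_F:X\to\overline{\mathbb R}$ such that: (1) $F=f_F^{-1}(+\infty)$ for each $F\in\tau^c$; (2) if $F_1,F_2\in\tau^c$ and $F_1\subset F_2$, then $f_{F_1}\le f_{F_2}$ (pointwise on $X$); (3) if $F\in\tau^c$ and $x\in X\setminus F$, then there exist an open neighborhood $V$ of $x$ and $m\in\mathbb N$ such that $f_F(y)\le m$ for each $y\in V$.
   Context: $\mathbb N$ is the set of positive integers and $\overline{\mathbb R}=\mathbb R\cup\{-\infty,+\infty\}$ with its usual order. A function $f:X\to\overline{\mathbb R}$ is lower semi-continuous if $\{x\in X:f(x)>r\}$ is open for each $r\in\mathbb R$. A space $X$ with topology $\tau$ is stratifiable if there is a map $\rho:\mathbb N\times\tau^c\to\tau$ such that (1) $F=\bigcap_{n\in\mathbb N}\rho(n,F)=\bigcap_{n\in\mathbb N}\overline{\rho(n,F)}$ for each $F\in\tau^c$; (2) if $F,H\in\tau^c$ and $F\subset H$, then $\rho(n,F)\subset\rho(n,H)$ for all $n\in\mathbb N$. *)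

(* Defs.v *)
From mathcomp Require Import all_boot all_order all_algebra.
From mathcomp Require Import all_classical all_reals all_analysis.

Set Implicit Arguments.
Unset Strict Implicit.
Unset Printing Implicit Defensive.

Local Open Scope classical_set_scope.

Definition posnat : set nat := [set n | (0 < n)%N].

(* A map rho from pairs (n, F), with n a positive integer and F closed, to open
   sets is encoded as a total function that is constrained only at such pairs. *)
Definition stratification (X : topologicalType) (rho : nat -> set X -> set X) :=
  [/\ forall n F, posnat n -> closed F -> open (rho n F),
      forall F, closed F ->
        F = \bigcap_(n in posnat) rho n F /\
        F = \bigcap_(n in posnat) closure (rho n F)
    & forall F H, closed F -> closed H -> F `<=` H ->
        forall n, posnat n -> rho n F `<=` rho n H].

Definition stratifiable (X : topologicalType) : Prop :=
  exists rho : nat -> set X -> set X, stratification rho.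

(* Main.v *)
Require Import Defs.
From mathcomp Require Import all_boot all_order all_algebra.
From mathcomp Require Import all_classical all_reals all_analysis.

(** A stratification and a family of lower semi-continuous functions give rise
    to each other by passing between a function and its superlevel sets: both are
    ways to measure how close a point is to F.  Given a stratification rho,
    send x to the supremum f_F x ([depth] below) of the n such that x lies in
    rho k F whenever 1 <= k <= n.  The set where f_F exceeds a real is a union
    of finite intersections of the rho k F, hence open, and f_F x is infinite
    exactly when x lies in every rho k F, that is, in F.  Conversely, the
    superlevel sets [f_F > n] of a family f form a stratification.

    The closure condition matches the local bound.  That F is the intersection
    of the closures of the rho n F means that each point outside F has a
    neighborhood disjoint from some rho m F.  A point outside rho m F has
    f_F <= m ([depth_le]), and a set on which f_F <= m misses [f_F > m], so
    such neighborhoods are carried over in both directions.  Monotonicity in F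
    passes through suprema and superlevel sets at once. *)

Import Order.TTheory GRing.Theory Num.Theory.

Local Open Scope classical_set_scope.
Local Open Scope ring_scope.
Local Open Scope ereal_scope.

(** The sets G k need not decrease in k, so the supremum is over the n up to
    which membership has not failed yet; n = 0 always qualifies, so the depth
    is never negative. *)
Definition depth (R : realType) (X : Type) (G : nat -> set X) (x : X) :
    \bar R :=
  ereal_sup [set n%:R%:E | n in
    [set n | forall k, posnat k -> (k <= n)%N -> G k x]].

Lemma le_depth (R : realType) (X : Type) (G H : nat -> set X) (x : X) :
  (forall k, posnat k -> G k `<=` H k) -> depth R X G x <= depth R X H x.
Proof.
move=> GH; apply: ereal_sup_le => _ [n Gn <-]; exists n => // k k0 kn.
exact/GH/Gn.
Qed.

Lemma depth_le (R : realType) (X : Type) (G : nat -> set X) (m : nat) (x : X) :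
  posnat m -> ~ G m x -> depth R X G x <= m%:R%:E.
Proof.
move=> m0 nGm; apply: ge_ereal_sup => _ [n Gn <-].
rewrite lee_fin ler_nat leqNgt; apply/negP => /ltnW mn.
exact/nGm/Gn.
Qed.

Lemma depth_eqy (R : realType) (X : Type) (G : nat -> set X) (x : X) :
  depth R X G x = +oo <-> (\bigcap_(n in posnat) G n) x.
Proof.
split=> [Gx n n0 | Gx].
  by apply: contrapT => /(depth_le R _ _ _ _ n0); rewrite Gx leye_eq.
apply: eq_infty => r; apply: le_ereal_sup_tmp.
exists (Num.truncn r).+1%:R%:E; last by rewrite lee_fin ltW ?truncnS_gt.
by exists (Num.truncn r).+1 => // k k0 _; exact: Gx.
Qed.

(** If depth exceeds a at x, some n > a witnesses it, and the witness persists
    on the intersection of the finitely many neighborhoods G k, 1 <= k <= n. *)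
Lemma lower_semicontinuous_depth (R : realType) (X : topologicalType)
    (G : nat -> set X) :
  (forall k, posnat k -> open (G k)) -> lower_semicontinuous (depth R X G).
Proof.
move=> Gop x a /ereal_sup_gt[_ [n Gn <-] an].
exists [set y | forall k, posnat k -> (k <= n)%N -> G k y]; last first.
  by move=> y Gy; apply: (lt_le_trans an); apply: ereal_sup_ubound; exists n.
elim: n Gn {an} => [_|n IHn Gn].
  by apply: nearW => y k; rewrite /posnat /= => k0; rewrite leqNgt k0.
have Gn1 : nbhs x (G n.+1) by apply: open_nbhs_nbhs; split; [exact: Gop|exact: Gn].
have /IHn Gn' : forall k, posnat k -> (k <= n)%N -> G k x.
  by move=> k k0 kn; exact/Gn/leqW.
apply: filterS2 Gn1 Gn' => y Gn1y Gny k k0.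
by rewrite leq_eqVlt => /predU1P[->|]; [|exact: Gny].
Qed.

Lemma notin_closureP (X : topologicalType) (A : set X) (x : X) :
  ~ closure A x <-> exists2 V, open_nbhs x V & V `<=` ~` A.
Proof.
split=> [nAx|[V /open_nbhs_nbhs xV VA] /(_ V xV)[y [Ay /VA]] //].
exists (~` closure A); last exact/subsetC/subset_closure.
by split=> //; exact/closed_openC/closed_closure.
Qed.

Theorem theorem5p3 (R : realType) (X : topologicalType)
    (hX : hausdorff_space X) :
  stratifiable X <->
  exists f : set X -> X -> \bar R,
    [/\ forall F : set X, closed F -> lower_semicontinuous (f F),
        forall F : set X, closed F -> F = f F @^-1` [set +oo],
        forall F1 F2 : set X, closed F1 -> closed F2 -> F1 `<=` F2 ->
          forall x : X, f F1 x <= f F2 x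
      & forall (F : set X) (x : X), closed F -> ~ F x ->
          exists (V : set X) (m : nat),
            [/\ open V, V x, posnat m & forall y : X, V y -> f F y <= m%:R%:E]].
Proof.
split=> [[rho [rho_open rhoI rho_mono]]|[f [f_lsc fy f_mono f_bnd]]].
  exists (fun F => depth R X (rho^~ F)); split.
  - by move=> F cF; apply: lower_semicontinuous_depth => k k0; exact: rho_open.
  - move=> F cF; rewrite [LHS](rhoI F cF).1.
    by apply/seteqP; split=> x /(depth_eqy R).
  - move=> F1 F2 cF1 cF2 F12 x; apply: le_depth => k k0.
    exact: rho_mono.
  - move=> F x cF; rewrite [in ~ _](rhoI F cF).2 => /existsNP[m].
    move=> /not_implyP[m0 /notin_closureP[V [Vop Vx] VG]].
    by exists V, m; split=> // y /VG; exact: depth_le.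
pose rho n F : set X := [set x | n%:R%:E < f F x].
have F_rho n F : closed F -> F `<=` rho n F.
  by move=> cF x; rewrite [X in X x](fy F cF) /rho /= => ->; exact: ltry.
have closure_rho F : closed F -> \bigcap_(n in posnat) closure (rho n F) `<=` F.
  move=> cF x xcl; apply: contrapT => /(f_bnd F x cF)[V [m [Vop Vx m0 fm]]].
  have /notin_closureP : exists2 V, open_nbhs x V & V `<=` ~` rho m F.
    by exists V => // y /fm; rewrite leNgt => /negP.
  by apply; exact: xcl.
exists rho; split.
- by move=> n F _ cF; move/lower_semicontinuousP: (f_lsc F cF); exact.
- move=> F cF; split; apply/seteqP; split.
  + by move=> x Fx n _; exact: F_rho.
  + by move=> x rx; apply: closure_rho => // n n0; exact/subset_closure/rx.
  + by move=> x Fx n _; exact/subset_closure/F_rho.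
  + exact: closure_rho.
- move=> F H cF cH FH n _ x; rewrite /rho /= => /lt_le_trans; apply.
  exact: f_mono.
Qed.
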